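(* Let $n\ge 1$, let $M\subset\mathbb{R}^n$ be a symmetric set and let $f\colon M\to\mathbb{R}^n$ be a symmetric function. Then $f$ is vector-monotone if and only if $f$ is matrix-monotone. Moreover, $f$ is strictly vector-monotone if and only if $f$ is strictly matrix-monotone.
   Context: A set $M\subset\mathbb{R}^n$ is called symmetric if $x\in M$ implies $(x_{\pi(1)},\dots,x_{\pi(n)})\in M$ for every permutation $\pi$ of $\{1,\dots,n\}$. $\mathrm{Sym}(n)$ denotes the real symmetric $n\times n$ matrices, $\mathrm{O}(n)$ the orthogonal group, and $\mathrm{Sym}(M)\subset\mathrm{Sym}(n)$ the set of symmetric matrices whose vector of eigenvalues (with multiplicity, in any order) lies in $M$. A function $f=(f_1,\dots,f_n)\colon M\to\mathbb{R}^n$ on a symmetric set $M$ is called symmetric if $f_i(\lambda_{\pi(1)},\dots,\lambda_{\pi(n)})=f_{\pi(i)}(\lambda_1,\dots,\lambda_n)$ for all $\lambda\in M$, all $i$ and all permutations $\pi$. For such $f$ there is a unique well-defined function $\Sigma_f\colon\mathrm{Sym}(M)\to\mathrm{Sym}(n)$ with $$\Sigma_f\big(Q^T\mathrm{diag}(\lambda_1,\dots,\lambda_n)\,Q\big)=Q^T\mathrm{diag}(f(\lambda_1,\dots,\lambda_n))\,Q\qquad\text{for all } Q\in\mathrm{O}(n),\ \lambda\in M.$$ $f$ is vector-monotone if $\langle f(x)-f(y),x-y\rangle\ge 0$ for all $x,y\in M$ (Euclidean inner product), and strictly vector-monotone if the inequality is strict for all $x\ne y$ in $M$. $f$ is matrix-monotone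 if $\langle \Sigma_f(S)-\Sigma_f(T),S-T\rangle\ge 0$ for all $S,T\in\mathrm{Sym}(M)$, where $\langle A,B\rangle=\mathrm{tr}(A^TB)$, and strictly matrix-monotone if the inequality is strict for all $S\neq T$ in $\mathrm{Sym}(M)$. *)

(* Defs.v *)
From mathcomp Require Import all_boot all_order all_algebra all_fingroup.
From mathcomp Require Import all_classical all_reals.

Set Implicit Arguments.
Unset Strict Implicit.
Unset Printing Implicit Defensive.

Import Order.TTheory GRing.Theory Num.Theory.
Local Open Scope classical_set_scope.
Local Open Scope ring_scope.

(* Vectors of R^n are row vectors, and [col_perm s x] is
   (x_{s(1)}, ..., x_{s(n)}). A function M -> R^n is a total function on R^n
   of which only the values on M are ever used. *)

Definition symmetric_set (R : realType) (n : nat) (M : set 'rV[R]_n) : Prop :=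
  forall (s : 'S_n) (x : 'rV[R]_n), M x -> M (col_perm s x).

Definition symmetric_fun (R : realType) (n : nat) (M : set 'rV[R]_n)
    (f : 'rV[R]_n -> 'rV[R]_n) : Prop :=
  forall (s : 'S_n) (x : 'rV[R]_n) (i : 'I_n),
    M x -> f (col_perm s x) 0 i = f x 0 (s i).

Definition dotv (R : realType) (n : nat) (x y : 'rV[R]_n) : R :=
  \sum_(i < n) x 0 i * y 0 i.

Definition dotM (R : realType) (n : nat) (A B : 'M[R]_n) : R :=
  \tr (A^T *m B).

Definition orthogonal_mx (R : realType) (n : nat) (Q : 'M[R]_n) : Prop :=
  Q^T *m Q = 1%:M.

(* The vector l lists the eigenvalues of S with multiplicity when the
   characteristic polynomial of S is \prod_i ('X - l_i). *)
Definition SymM (R : realType) (n : nat) (M : set 'rV[R]_n) : set 'M[R]_n :=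
  [set S | S^T = S /\
     exists2 l : 'rV[R]_n,
       M l & char_poly S = \prod_(i < n) ('X - (l 0 i)%:P)].

(* The defining relation of Sigma_f determines the value below uniquely, see
   [SigmaE]; matrices that are not of the form Q^T diag(l) Q with l in M get
   the value 0. *)
Definition Sigma (R : realType) (n : nat) (M : set 'rV[R]_n)
    (f : 'rV[R]_n -> 'rV[R]_n) (S : 'M[R]_n) : 'M[R]_n :=
  xget 0 [set T | exists (Q : 'M[R]_n) (l : 'rV[R]_n),
    [/\ orthogonal_mx Q, M l, S = Q^T *m diag_mx l *m Q
      & T = Q^T *m diag_mx (f l) *m Q]].

Definition vector_monotone (R : realType) (n : nat) (M : set 'rV[R]_n)
    (f : 'rV[R]_n -> 'rV[R]_n) : Prop :=
  forall x y : 'rV[R]_n, M x -> M y -> 0 <= dotv (f x - f y) (x - y).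

Definition strictly_vector_monotone (R : realType) (n : nat)
    (M : set 'rV[R]_n) (f : 'rV[R]_n -> 'rV[R]_n) : Prop :=
  forall x y : 'rV[R]_n, M x -> M y -> x <> y -> 0 < dotv (f x - f y) (x - y).

Definition matrix_monotone (R : realType) (n : nat) (M : set 'rV[R]_n)
    (f : 'rV[R]_n -> 'rV[R]_n) : Prop :=
  forall S T : 'M[R]_n, SymM M S -> SymM M T ->
    0 <= dotM (Sigma M f S - Sigma M f T) (S - T).

Definition strictly_matrix_monotone (R : realType) (n : nat)
    (M : set 'rV[R]_n) (f : 'rV[R]_n -> 'rV[R]_n) : Prop :=
  forall S T : 'M[R]_n, SymM M S -> SymM M T -> S <> T ->
    0 < dotM (Sigma M f S - Sigma M f T) (S - T).

Lemma char_poly_orthogonal (R : realType) (n : nat) (Q : 'M[R]_n)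
    (l : 'rV[R]_n) :
  orthogonal_mx Q ->
  char_poly (Q^T *m diag_mx l *m Q) = \prod_(i < n) ('X - (l 0 i)%:P).
Proof.
move=> QQ.
have -> : \prod_(i < n) ('X - (l 0 i)%:P) = char_poly (diag_mx l).
  rewrite char_poly_trig; last exact/is_diag_mx_is_trig/diag_mx_is_diag.
  by apply: eq_bigr => i _; rewrite mxE eqxx mulr1n.
have QQp : map_mx polyC Q^T *m map_mx polyC Q = 1%:M.
  by rewrite -map_mxM QQ map_mx1.
rewrite /char_poly /char_poly_mx !map_mxM.
have E : 'X%:M = map_mx polyC Q^T *m 'X%:M *m map_mx polyC Q :> 'M[{poly R}]_n.
  by rewrite scalar_mxC -mulmxA QQp mulmx1.
rewrite [in LHS]E -mulmxBl -mulmxBr !det_mulmx mulrAC -det_mulmx QQp.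
by rewrite det1 mul1r.
Qed.

Lemma SymM_orthogonal (R : realType) (n : nat) (M : set 'rV[R]_n)
    (Q : 'M[R]_n) (l : 'rV[R]_n) :
  orthogonal_mx Q -> M l -> SymM M (Q^T *m diag_mx l *m Q).
Proof.
move=> QQ Ml; split; first by rewrite !trmx_mul trmxK tr_diag_mx mulmxA.
by exists l => //; exact: char_poly_orthogonal.
Qed.

Lemma eigen_perm (R : realType) (n : nat) (l m : 'rV[R]_n) :
  \prod_(i < n) ('X - (l 0 i)%:P) = \prod_(i < n) ('X - (m 0 i)%:P) ->
  exists s : 'S_n, m = col_perm s l.
Proof.
move=> E; pose t (x : 'rV[R]_n) := [tuple x 0 i | i < n].
have Et (x : 'rV[R]_n) : \prod_(i < n) ('X - (x 0 i)%:P) = \prod_(a <- t x) ('X - a%:P).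
  by rewrite big_map big_enum.
have : perm_eq (t m) (t l).
  by apply: prod_XsubC_eq; rewrite -!Et.
case/tuple_permP => s Es; exists s; apply/rowP => i; rewrite !mxE.
have /(congr1 (fun u : n.-tuple R => tnth u i)) : t m = [tuple tnth (t l) (s i) | i < n].
  exact: val_inj.
by rewrite !tnth_mktuple.
Qed.

Lemma SigmaE (R : realType) (n : nat) (M : set 'rV[R]_n)
    (f : 'rV[R]_n -> 'rV[R]_n) (Q : 'M[R]_n) (l : 'rV[R]_n) :
  symmetric_fun M f -> orthogonal_mx Q -> M l ->
  Sigma M f (Q^T *m diag_mx l *m Q) = Q^T *m diag_mx (f l) *m Q.
Proof.
move=> fS QQ Ml; apply: xget_unique; first by exists Q, l.
move=> T [P [m [PP Mm E ->]]].
have [s ms] : exists s : 'S_n, m = col_perm s l.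
  by apply: eigen_perm; rewrite -(char_poly_orthogonal _ QQ) E
    char_poly_orthogonal.
have PP' : P *m P^T = 1%:M by apply: mulmx1C.
have QQ' : Q *m Q^T = 1%:M by apply: mulmx1C.
pose U := P *m Q^T.
have EU : diag_mx m *m U = U *m diag_mx l.
  rewrite /U -[LHS]mul1mx -PP' -!mulmxA (mulmxA P^T) (mulmxA _ P) -E.
  by rewrite -!mulmxA QQ' mulmx1.
have EfU : diag_mx (f m) *m U = U *m diag_mx (f l).
  apply/matrixP => i j; rewrite mul_diag_mx mul_mx_diag [LHS]mxE [RHS]mxE.
  move/matrixP/(_ i j): EU; rewrite mul_diag_mx mul_mx_diag [LHS]mxE [RHS]mxE.
  have [-> _|Uij] := eqVneq (U i j) 0; first by rewrite mulr0 mul0r.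
  rewrite mulrC => /(mulfI Uij) mlij; rewrite mulrC; congr (_ * _).
  have lij : l 0 (s i) = l 0 j by rewrite -mlij ms mxE.
  have lt : col_perm (tperm (s i) j) l = l.
    by apply/rowP => k; rewrite mxE; case: tpermP => // ->.
  by rewrite ms fS // -[in LHS]lt fS // tpermL.
have UQ : U *m Q = P by rewrite /U -mulmxA QQ mulmx1.
rewrite -[X in _ *m X = _]UQ mulmxA -(mulmxA P^T) EfU !mulmxA.
by rewrite PP mul1mx.
Qed.

(* Main.v *)
Require Import Defs.
From mathcomp Require Import all_boot all_order all_algebra all_fingroup.
From mathcomp Require Import all_classical all_reals.
From mathcomp Require Import ring.
(** Write S = Q^T diag(l) Q and T = P^T diag(m) P, and put W = Q P^T.  Since
S - T = Q^T (diag(l) W - W diag(m)) P, and likewise for the images under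
Sigma, the trace pairing becomes
   <Sigma S - Sigma T, S - T>
     = sum_(i,j) W_ij^2 (f(l)_i - f(m)_j) (l_i - m_j),
and the weights W_ij^2 form a doubly stochastic matrix
([dotM_diag_conj], [orthogonal_doubly_stochastic]).

As M is symmetric, both eigenvalue vectors may be listed in nonincreasing
order.  Comparing a vector with the one in which two coordinates are exchanged
shows that vector-monotonicity makes f(l) and f(m) nonincreasing as well
([monotone_nonincreasing]).  After expansion, the terms f(l)_i l_i and
f(m)_j m_j do not depend on the weights, and the cross terms f(l)_i m_j and
l_i f(m)_j, which enter with a minus sign, are largest for the identity
weights, by the rearrangement inequality for doubly stochastic matrices
([rearrangement]).  Hence the double sum is at least <f(l) - f(m), l - m>
([Sigma_dotM_ge]), which is nonnegative, and positive in the strict case when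
l and m differ.

If l = m in the strict case, each term W_ij^2 (f(l)_i - f(l)_j) (l_i - l_j) is
nonnegative, by exchanging two coordinates again, and it vanishes only if
W_ij (l_i - l_j) = 0; these numbers are the entries of Q (S - T) P^T, so they
do not all vanish when S and T differ ([Sigma_dotM_isospectral_gt0]).

The converse implications restrict the matrix inequality to diagonal matrices.
The diagonalisation itself needs no existence theorem for eigenvalues, because
membership in SymM provides a real factorisation of the characteristic
polynomial ([spectral_decomposition]). *)

Set Implicit Arguments.
Unset Strict Implicit.
Unset Printing Implicit Defensive.
Import Order.TTheory GRing.Theory Num.Theory.
Local Open Scope classical_set_scope.
Local Open Scope ring_scope.

(** * Rearrangement for doubly stochastic weights *)

Definition nonincreasing (R : realFieldType) n (a : 'I_n -> R) : Prop :=
  forall i j : 'I_n, (i <= j)%N -> a j <= a i.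

Definition doubly_stochastic (R : realFieldType) n (D : 'M[R]_n) : Prop :=
  [/\ forall i j, 0 <= D i j, forall i, \sum_j D i j = 1
    & forall j, \sum_i D i j = 1].

(** Summation by parts as an induction: with C_k the partial sums of c, the bound
for k passes to k+1 because a_(k+1) C_k <= a_k C_k when C_k is nonnegative. *)
Lemma abel_le (R : realFieldType) n (c a : 'I_n.+1 -> R) :
  nonincreasing a -> (forall k : 'I_n.+1, 0 <= \sum_(i < _ | (i <= k)%N) c i) ->
  a ord_max * \sum_i c i <= \sum_i c i * a i.
Proof.
elim: n c a => [|n IHn] c a aN cP.
  by rewrite !big_ord1 (_ : ord_max = ord0) 1?mulrC//; exact: val_inj.
pose w := widen_ord (leqnSn n.+1).
have wP (k : 'I_n.+1) : \sum_(i < n.+1 | (i <= k)%N) c (w i) =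
    \sum_(i < n.+2 | (i <= w k)%N) c i.
  by rewrite big_mkcond [RHS]big_mkcond [RHS]big_ord_recr /= leqNgt ltn_ord addr0.
have := IHn (c \o w) (a \o w) (fun i j => aN (w i) (w j)).
have {}cP (k : 'I_n.+1) : 0 <= \sum_(i < n.+1 | (i <= k)%N) (c \o w) i by rewrite wP.
have cT : 0 <= \sum_i (c \o w) i.
  rewrite (le_trans (cP ord_max))// le_eqVlt; apply/orP; left; apply/eqP.
  by apply: eq_bigl => i; rewrite -ltnS ltn_ord.
move=> /(_ cP) Hle; rewrite big_ord_recr [X in _ <= X]big_ord_recr /=.
rewrite mulrDr [a _ * c _]mulrC lerD2r (le_trans _ Hle)// ler_wpM2r//.
by apply: aN; rewrite /= leqnSn.
Qed.

Lemma abel_ge0 (R : realFieldType) n (c a : 'I_n -> R) :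
  nonincreasing a -> (forall k : 'I_n, 0 <= \sum_(i < _ | (i <= k)%N) c i) ->
  \sum_i c i = 0 -> 0 <= \sum_i c i * a i.
Proof.
case: n c a => [|n] c a aN cP c0; first by rewrite big_ord0.
by have := abel_le aN cP; rewrite c0 mulr0.
Qed.

(** By [abel_ge0] it suffices that the k+1 largest values of b have at least the
sum of any averaged selection of total weight k+1.  The selection gives j the
weight [s j] in [0, 1]; moving weight across the pivot b_k can only
decrease the sum. *)
Lemma rearrangement (R : realFieldType) n (D : 'M[R]_n) (a b : 'I_n -> R) :
  doubly_stochastic D -> nonincreasing a -> nonincreasing b ->
  \sum_i \sum_j D i j * (a i * b j) <= \sum_i a i * b i.
Proof.
move=> [D0 Dr Dc] aN bN.
rewrite -subr_ge0 -sumrB.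
rewrite [leRHS](_ : _ = \sum_i (b i - \sum_j D i j * b j) * a i); last first.
  apply: eq_bigr => i _; rewrite mulrBl mulr_suml mulrC; congr (_ - _).
  by apply: eq_bigr => j _; ring.
apply: abel_ge0 => // [k|]; last first.
  rewrite sumrB exchange_big /= -sumrB big1// => j _.
  by rewrite -mulr_suml Dc mul1r subrr.
(* The total weight being preserved, b k can be subtracted from every b j. *)
pose s j := \sum_(i < n | (i <= k)%N) D i j.
have sN : \sum_(j < n) ((j <= k)%N%:R - s j) = 0.
  rewrite sumrB /s exchange_big /= [X in _ - X](eq_bigr (fun=> 1)) => [|i _//].
  by rewrite [X in _ - X]big_mkcond -sumrB big1// => j _; case: leqP; rewrite subrr.
rewrite [leRHS](_ : _ = \sum_(j < n) ((j <= k)%N%:R - s j) * (b j - b k)).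
  apply: sumr_ge0 => j _; case: leqP => jk.
    rewrite mulr_ge0// subr_ge0 ?bN// -(Dc j).
    by rewrite /s [leLHS]big_mkcond ler_sum// => i _; case: ifP.
  by rewrite mulr_le0// ?subr_le0 ?bN 1?ltnW// sumr_ge0.
under [RHS]eq_bigr do rewrite mulrBr.
rewrite [RHS]sumrB -[X in _ = _ - X]mulr_suml sN mul0r subr0 sumrB exchange_big /=.
rewrite [X in X - _]big_mkcond -sumrB; apply: eq_bigr => j _.
by rewrite -mulr_suml mulrBl; case: ifP; rewrite ?mul1r ?mul0r.
Qed.

(** * Orthogonal diagonalisation of symmetric matrices *)

Lemma orthogonal_mxM (R : realType) n (P Q : 'M[R]_n) :
  orthogonal_mx P -> orthogonal_mx Q -> orthogonal_mx (P *m Q).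
Proof.
move=> PP QQ; rewrite /orthogonal_mx trmx_mul -mulmxA (mulmxA P^T) PP.
by rewrite mul1mx.
Qed.

Lemma orthogonal_mxT (R : realType) n (Q : 'M[R]_n) :
  orthogonal_mx Q -> orthogonal_mx Q^T.
Proof. by move=> /mulmx1C; rewrite /orthogonal_mx trmxK. Qed.

Lemma mulmx_trE (R : realType) n (v : 'rV[R]_n) :
  (v *m v^T) 0 0 = \sum_i v 0 i ^+ 2.
Proof. by rewrite mxE; apply: eq_bigr => i _; rewrite mxE expr2. Qed.

Lemma row_norm_eq0 (R : realType) n (v : 'rV[R]_n) :
  ((v *m v^T) 0 0 == 0) = (v == 0).
Proof.
apply/eqP/eqP => [|->]; last by rewrite mul0mx mxE.
rewrite mulmx_trE => /psumr_eq0P v0; apply/rowP => i; rewrite mxE.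
by apply/eqP; rewrite -sqrf_eq0 v0// => j _; rewrite sqr_ge0.
Qed.

(** The Householder reflection that exchanges e and v, where e is the first
basis vector; it degenerates when e = v. *)
Lemma orthogonal_first_row (R : realType) n (v : 'rV[R]_n.+1) :
  v *m v^T = 1%:M ->
  exists2 Q : 'M[R]_n.+1, orthogonal_mx Q & row 0 Q = v.
Proof.
move=> v1; pose e : 'rV[R]_n.+1 := delta_mx 0 0.
have e1 : e *m e^T = 1%:M.
  by apply/matrixP => i j; rewrite !ord1 /e trmx_delta mul_delta_mx !mxE.
pose w := e - v; pose q := (w *m w^T) 0 0.
have [w0|w0] := eqVneq w 0.
  exists 1%:M; first by rewrite /orthogonal_mx trmx1 mulmx1.
  by rewrite row1 -/e; apply/eqP; rewrite -subr_eq0 -/w w0.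
have q0 : q != 0 by rewrite /q row_norm_eq0.
have wwE : w *m w^T = q%:M by rewrite [LHS]mx11_scalar.
(* |e - v|^2 = 2 - 2 <e, v> = 2 <e, e - v> for unit vectors. *)
have ve : v *m e^T = e *m v^T.
  by rewrite -[RHS]trmxK trmx_mul trmxK (mx11_scalar (v *m e^T)) tr_scalar_mx.
have ewE : e *m w^T = (q / 2)%:M.
  suff : q%:M = 2%:R *: (e *m w^T).
    move=> /(congr1 (fun A => 2%:R^-1 *: A)); rewrite scalerA mulVf ?pnatr_eq0//.
    by rewrite scale1r scale_scalar_mx mulrC => ->.
  rewrite -wwE linearB /= mulmxBl !mulmxBr e1 v1 ve.
  by rewrite scaler_nat mulr2n opprB.
have ewv : e - w = v by rewrite /w subKr.
clearbody w.
pose Q : 'M[R]_n.+1 := 1%:M - (2 / q) *: (w^T *m w).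
have QT : Q^T = Q.
  by rewrite /Q linearB /= linearZ /= trmx1 trmx_mul trmxK.
exists Q.
  rewrite /orthogonal_mx QT {1}/Q mulmxBl mul1mx -scalemxAl /Q.
  rewrite mulmxBr mulmx1 -scalemxAr mulmxA -(mulmxA _ w) wwE.
  rewrite mul_mx_scalar -scalemxAl scalerA divfK// scalerBr.
  rewrite scaler_nat mulr2n scalerDr opprB.
  by rewrite addrK subrK.
rewrite rowE -/e /Q mulmxBr mulmx1 -scalemxAr mulmxA ewE mul_scalar_mx scalerA.
by rewrite mulrA divfK// divff ?pnatr_eq0// scale1r.
Qed.

Lemma char_poly_conj (R : realType) n (Q S : 'M[R]_n) :
  orthogonal_mx Q -> char_poly (Q *m S *m Q^T) = char_poly S.
Proof.
move=> QQ; pose q := map_mx (@polyC R) Q; pose q' := map_mx (@polyC R) Q^T.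
have q'q : q' *m q = 1%:M by rewrite -map_mxM QQ map_mx1.
have qq' : q *m q' = 1%:M by exact: mulmx1C.
rewrite /char_poly (_ : char_poly_mx _ = q *m char_poly_mx S *m q').
  by rewrite !det_mulmx mulrAC -det_mulmx qq' det1 mul1r.
rewrite /char_poly_mx !map_mxM mulmxBr mulmxBl; congr (_ - _).
by rewrite scalar_mxC -mulmxA qq' mulmx1.
Qed.

(** The first row of A being supported on the diagonal, so is its first column,
by symmetry. *)
Lemma symmetric_deflation (R : realType) n (A : 'M[R]_(1 + n)) (a : R) :
  A^T = A -> row 0 A = a *: delta_mx 0 0 ->
  A = block_mx a%:M 0 0 (drsubmx A).
Proof.
move=> AT A0; have ur : ursubmx A = 0.
  apply/matrixP => i j; rewrite !mxE !ord1.
  have /rowP/(_ (rshift 1 j)) := A0; rewrite !mxE/= mulr0 => E.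
  by rewrite -[RHS]E; congr (A _ _); apply: val_inj.
rewrite -[LHS]submxK; congr block_mx => //.
  apply/matrixP => i j; rewrite !mxE !ord1 eqxx mulr1n.
  have /rowP/(_ (lshift n 0)) := A0; rewrite !mxE/= mulr1 => E.
  by rewrite -[RHS]E; congr (A _ _); apply: val_inj.
by apply: trmx_inj; rewrite trmx_dlsub AT ur trmx0.
Qed.

(** Induction on the given list of roots: the first one has a unit eigenvector,
an orthogonal change of basis turns it into the first basis vector, and the
remaining diagonal block has the other roots.  Following the list yields the
eigenvalues in the prescribed order. *)
Lemma spectral_decomposition (R : realType) n (S : 'M[R]_n) (l : 'rV[R]_n) :
  S^T = S -> char_poly S = \prod_(i < n) ('X - (l 0 i)%:P) ->
  exists2 Q : 'M[R]_n, orthogonal_mx Q & S = Q^T *m diag_mx l *m Q.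
Proof.
elim: n S l => [|n IHn] S l ST Sl.
  by exists 1%:M; apply/matrixP => -[].
have /eigenvalueP[u uS u0] : eigenvalue S (l 0 0).
  by rewrite eigenvalue_root_char Sl big_ord_recl rootM root_XsubC eqxx.
have q_gt0 : 0 < (u *m u^T) 0 0.
  by rewrite lt_neqAle eq_sym row_norm_eq0 u0 mulmx_trE sumr_ge0// => i _; exact: sqr_ge0.
pose v := (Num.sqrt ((u *m u^T) 0 0))^-1 *: u.
have v1 : v *m v^T = 1%:M.
  rewrite /v linearZ /= -scalemxAl -scalemxAr scalerA -expr2 exprVn.
  rewrite sqr_sqrtr ?ltW// [u *m _]mx11_scalar scale_scalar_mx.
  by rewrite mxE mulr1n mulVf// gt_eqF.
have vS : v *m S = l 0 0 *: v by rewrite /v -scalemxAl uS !scalerA mulrC.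
have [Q QQ Qv] := orthogonal_first_row v1.
have QQT : Q *m Q^T = 1%:M by exact: mulmx1C.
pose A : 'M[R]_(1 + n) := Q *m S *m Q^T.
have AT : A^T = A by rewrite /A !trmx_mul trmxK ST mulmxA.
have A0 : row 0 A = l 0 0 *: delta_mx 0 0.
  by rewrite !row_mul Qv vS -scalemxAl -{1}Qv -row_mul QQT row1.
have AE := symmetric_deflation AT A0.
pose l' : 'rV[R]_n := \row_i l 0 (lift ord0 i).
have lE : diag_mx l = block_mx (l 0 0)%:M 0 0 (diag_mx l') :> 'M_(1 + n).
  have lr : l = row_mx (l 0 0)%:M l' :> 'rV_(1 + n).
    apply/rowP => i; case: (split_ordP i) => j ->.
      by rewrite row_mxEl ord1 mxE mulr1n; congr (l _ _); apply: val_inj.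
    by rewrite row_mxEr mxE; congr (l _ _); apply: val_inj.
  rewrite [in LHS]lr; apply: etrans (diag_mx_row _ _) _; congr block_mx.
  apply/matrixP => i j.
  by rewrite !ord1 !mxE.
have BT : (drsubmx A)^T = drsubmx A by rewrite trmx_drsub AT.
have Bl : char_poly (drsubmx A) = \prod_(i < n) ('X - (l' 0 i)%:P).
  have cA : char_poly A = char_poly S by exact: char_poly_conj.
  rewrite Sl AE /char_poly char_block_diag_mx det_ublock det_mx11 !mxE in cA.
  rewrite mulr1n big_ord_recl in cA.
  have := mulfI (negbT (polyXsubC_eq0 _)) cA; rewrite /char_poly => ->.
  by apply: eq_bigr => i _; rewrite mxE.
have [P PP BP] := IHn _ _ BT Bl.
pose P' : 'M[R]_(1 + n) := block_mx 1%:M 0 0 P.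
have P'T : P'^T = block_mx 1%:M 0 0 P^T by rewrite tr_block_mx !trmx0 trmx1.
have P'P' : orthogonal_mx P'.
  rewrite /orthogonal_mx P'T mulmx_block !mulmx0 !mul0mx mulmx1 !addr0 add0r.
  by rewrite PP -scalar_mx_block.
exists (P' *m Q); first exact: orthogonal_mxM.
have {}AE : A = P'^T *m block_mx (l 0 0)%:M 0 0 (diag_mx l') *m P'.
  rewrite [LHS]AE BP P'T /P' !mulmx_block !mulmx0 !mul0mx !addr0 !add0r.
  by rewrite !mul0mx mul1mx mulmx1.
have SA : S = Q^T *m A *m Q.
  by rewrite /A !mulmxA QQ mul1mx -mulmxA QQ mulmx1.
by rewrite [LHS]SA AE lE trmx_mul !mulmxA.
Qed.


(** * Sorted eigenvalues *)

Lemma exists_sort_perm (R : realFieldType) n (x : 'rV[R]_n) :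
  exists s : 'S_n, nonincreasing (col_perm s x 0).
Proof.
pose t := [tuple x 0 i | i < n].
have : perm_eq (sort_tuple >=%O t) t by rewrite perm_sort.
case/tuple_permP => s Es; exists s => i j ij.
have tE k : col_perm s x 0 k = nth 0 (sort >=%O t) k.
  rewrite mxE -[RHS]/(nth 0 (sort_tuple >=%O t) k) Es -tnth_nth.
  by rewrite !tnth_mktuple.
have tS : sorted >=%O (sort >=%O t) by exact/sort_sorted/ge_total.
rewrite !tE; apply: (sorted_leq_nth ge_trans ge_refl 0 tS) ij;
  by rewrite inE size_sort size_tuple.
Qed.

Lemma SymM_sorted (R : realType) n (M : set 'rV[R]_n) (S : 'M[R]_n) :
  symmetric_set M -> SymM M S ->
  exists (Q : 'M[R]_n) (l : 'rV[R]_n),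
    [/\ orthogonal_mx Q, M l, nonincreasing (l 0) & S = Q^T *m diag_mx l *m Q].
Proof.
move=> hM [ST [l Ml Sl]]; have [s sl] := exists_sort_perm l.
have [|Q QQ SE] := @spectral_decomposition _ _ S (col_perm s l) ST.
  rewrite Sl (reindex_inj (@perm_inj _ s)) /=.
  by apply: eq_bigr => i _; rewrite mxE.
by exists Q, (col_perm s l); split => //; exact: hM.
Qed.

(** * The trace pairing in terms of eigenvalues *)

Lemma dotM_orthogonal (R : realType) n (P Q X Y : 'M[R]_n) :
  orthogonal_mx P -> orthogonal_mx Q ->
  dotM (Q^T *m X *m P) (Q^T *m Y *m P) = \sum_i \sum_j X i j * Y i j.
Proof.
move=> PP /mulmx1C QQ; rewrite /dotM !trmx_mul trmxK.
rewrite !mulmxA mxtrace_mulC !mulmxA (mulmx1C PP) mul1mx.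
rewrite -(mulmxA X^T) QQ mulmx1 exchange_big /=; apply: eq_bigr => i _.
by rewrite mxE; apply: eq_bigr => j _; rewrite mxE.
Qed.

(** Both terms are brought to the common frame Q^T _ P, in which the difference
is diag(a) W - W diag(b) with W = Q P^T. *)
Lemma diag_conj_sub (R : realType) n (P Q : 'M[R]_n) (a b : 'rV[R]_n) :
  orthogonal_mx P -> orthogonal_mx Q ->
  Q^T *m diag_mx a *m Q - P^T *m diag_mx b *m P =
  Q^T *m (\matrix_(i, j) ((Q *m P^T) i j * (a 0 i - b 0 j))) *m P.
Proof.
move=> PP QQ; set W := Q *m P^T.
have -> : (\matrix_(i, j) (W i j * (a 0 i - b 0 j))) =
    diag_mx a *m W - W *m diag_mx b.
  apply/matrixP => i j; rewrite mul_diag_mx mul_mx_diag.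
  by rewrite ![in LHS]mxE ![in RHS]mxE; ring.
rewrite mulmxBr mulmxBl /W !mulmxA QQ mul1mx; congr (_ - _).
by rewrite -!mulmxA PP mulmx1.
Qed.

(** The rows and the columns of W are unit vectors. *)
Lemma orthogonal_doubly_stochastic (R : realType) n (W : 'M[R]_n) :
  orthogonal_mx W -> doubly_stochastic (map_mx (fun x => x ^+ 2) W).
Proof.
move=> WW; split=> [i j|i|j]; first by rewrite mxE sqr_ge0.
  have /matrixP/(_ i i) := mulmx1C WW; rewrite !mxE eqxx => E; rewrite -[RHS]E.
  by apply: eq_bigr => j _; rewrite !mxE expr2.
have /matrixP/(_ j j) := WW; rewrite !mxE eqxx => E; rewrite -[RHS]E.
by apply: eq_bigr => i _; rewrite !mxE expr2.
Qed.

Lemma dotM_diag_conj (R : realType) n (P Q : 'M[R]_n) (a b l m : 'rV[R]_n) :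
  orthogonal_mx P -> orthogonal_mx Q ->
  dotM (Q^T *m diag_mx a *m Q - P^T *m diag_mx b *m P)
       (Q^T *m diag_mx l *m Q - P^T *m diag_mx m *m P) =
  \sum_i \sum_j (Q *m P^T) i j ^+ 2 * ((a 0 i - b 0 j) * (l 0 i - m 0 j)).
Proof.
move=> PP QQ; rewrite !diag_conj_sub// dotM_orthogonal//.
by apply: eq_bigr => i _; apply: eq_bigr => j _; rewrite !mxE; ring.
Qed.

(** The right-hand side minus the left-hand side is the sum of two
rearrangement defects, one for the pair (a, m) and one for (l, b). *)
Lemma dotv_le_doubly_stochastic (R : realType) n (D : 'M[R]_n)
    (a b l m : 'rV[R]_n) :
  doubly_stochastic D -> nonincreasing (a 0) -> nonincreasing (b 0) ->
  nonincreasing (l 0) -> nonincreasing (m 0) ->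
  dotv (a - b) (l - m) <=
  \sum_i \sum_j D i j * ((a 0 i - b 0 j) * (l 0 i - m 0 j)).
Proof.
move=> DD aN bN lN mN; have [_ Dr Dc] := DD.
have -> : \sum_i \sum_j D i j * ((a 0 i - b 0 j) * (l 0 i - m 0 j)) =
    \sum_i a 0 i * l 0 i + \sum_i b 0 i * m 0 i
    - (\sum_i \sum_j D i j * (a 0 i * m 0 j)
       + \sum_i \sum_j D i j * (l 0 i * b 0 j)).
  rewrite (_ : \sum_i a 0 i * l 0 i = \sum_i \sum_j D i j * (a 0 i * l 0 i)).
    rewrite (_ : \sum_i b 0 i * m 0 i = \sum_i \sum_j D i j * (b 0 j * m 0 j)).
      rewrite -!big_split -sumrB /=; apply: eq_bigr => i _.
      by rewrite -!big_split -sumrB /=; apply: eq_bigr => j _; ring.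
    by rewrite exchange_big; apply: eq_bigr => j _; rewrite -mulr_suml Dc mul1r.
  by apply: eq_bigr => i _; rewrite -mulr_suml Dr mul1r.
have -> : dotv (a - b) (l - m) =
    \sum_i a 0 i * l 0 i + \sum_i b 0 i * m 0 i
    - (\sum_i a 0 i * m 0 i + \sum_i l 0 i * b 0 i).
  rewrite -!big_split -sumrB; apply: eq_bigr => i _.
  by rewrite !mxE /=; ring.
by rewrite lerD2l lerN2 lerD// rearrangement.
Qed.

(** * Consequences of vector-monotonicity *)

(** Only the coordinates i and j contribute, and they contribute equally. *)
Lemma dotv_tperm (R : realType) n (M : set 'rV[R]_n)
    (f : 'rV[R]_n -> 'rV[R]_n) (x : 'rV[R]_n) (i j : 'I_n) :
  symmetric_fun M f -> M x ->
  dotv (f x - f (col_perm (tperm i j) x)) (x - col_perm (tperm i j) x) =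
  ((f x 0 i - f x 0 j) * (x 0 i - x 0 j)) *+ 2.
Proof.
move=> hf Mx; rewrite /dotv.
under eq_bigr do rewrite !mxE (hf _ _ _ Mx).
have [<-|ij] := eqVneq i j.
  rewrite tperm1 big1 => [|k _]; last by rewrite perm1 subrr mul0r.
  by rewrite subrr mul0r mul0rn.
rewrite (bigD1 i)//= (bigD1 j) 1?eq_sym//= big1 => [|k /andP[ki kj]].
  by rewrite tpermL tpermR addr0; ring.
by rewrite tpermD 1?eq_sym// subrr mul0r.
Qed.

(** If x_i > x_j, exchanging them and applying monotonicity orders f(x)_i and
f(x)_j; if x_i = x_j, the symmetry of f makes these two values equal. *)
Lemma monotone_nonincreasing (R : realType) n (M : set 'rV[R]_n)
    (f : 'rV[R]_n -> 'rV[R]_n) (x : 'rV[R]_n) :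
  symmetric_set M -> symmetric_fun M f -> vector_monotone M f -> M x ->
  nonincreasing (x 0) -> nonincreasing (f x 0).
Proof.
move=> hM hf fm Mx xN i j ij.
have := fm _ _ Mx (hM (tperm i j) _ Mx); rewrite (dotv_tperm _ _ hf Mx).
rewrite pmulrn_lge0//; have := xN _ _ ij; rewrite le_eqVlt => /predU1P[xij _|xij].
  have xE : col_perm (tperm i j) x = x.
    by apply/rowP => k; rewrite mxE; case: tpermP => // ->.
  by rewrite -[in leLHS]xE hf// tpermR.
by rewrite pmulr_lge0 ?subr_gt0// subr_ge0.
Qed.

Lemma strictly_vector_monotoneW (R : realType) n (M : set 'rV[R]_n)
    (f : 'rV[R]_n -> 'rV[R]_n) :
  strictly_vector_monotone M f -> vector_monotone M f.
Proof.
move=> fm x y Mx My; have [->|/eqP xy] := eqVneq x y; last exact/ltW/fm.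
by rewrite /dotv big1// => i _; rewrite !subrr mxE mul0r.
Qed.

Lemma Sigma_dotM_ge (R : realType) n (M : set 'rV[R]_n)
    (f : 'rV[R]_n -> 'rV[R]_n) (P Q : 'M[R]_n) (l m : 'rV[R]_n) :
  symmetric_set M -> symmetric_fun M f -> vector_monotone M f ->
  orthogonal_mx P -> orthogonal_mx Q -> M l -> M m ->
  nonincreasing (l 0) -> nonincreasing (m 0) ->
  dotv (f l - f m) (l - m) <=
  dotM (Sigma M f (Q^T *m diag_mx l *m Q) - Sigma M f (P^T *m diag_mx m *m P))
       (Q^T *m diag_mx l *m Q - P^T *m diag_mx m *m P).
Proof.
move=> hM hf fm PP QQ Ml Mm lN mN; rewrite !SigmaE// dotM_diag_conj//.
have /orthogonal_doubly_stochastic DD : orthogonal_mx (Q *m P^T).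
  by apply: orthogonal_mxM => //; exact: orthogonal_mxT.
have fl := monotone_nonincreasing hM hf fm Ml lN.
have fM := monotone_nonincreasing hM hf fm Mm mN.
have := dotv_le_doubly_stochastic DD fl fM lN mN.
by under eq_bigr do under eq_bigr do rewrite mxE.
Qed.

(** For equal spectra [Sigma_dotM_ge] only gives nonnegativity, so the terms of
the double sum are examined one by one; if they all vanish, so does the
matrix of the W_ij (l_i - l_j), and then the two conjugates coincide. *)
Lemma Sigma_dotM_isospectral_gt0 (R : realType) n (M : set 'rV[R]_n)
    (f : 'rV[R]_n -> 'rV[R]_n) (P Q : 'M[R]_n) (l : 'rV[R]_n) :
  symmetric_set M -> symmetric_fun M f -> strictly_vector_monotone M f ->
  orthogonal_mx P -> orthogonal_mx Q -> M l ->
  Q^T *m diag_mx l *m Q <> P^T *m diag_mx l *m P ->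
  0 < dotM (Sigma M f (Q^T *m diag_mx l *m Q) -
            Sigma M f (P^T *m diag_mx l *m P))
       (Q^T *m diag_mx l *m Q - P^T *m diag_mx l *m P).
Proof.
move=> hM hf fm PP QQ Ml ST; rewrite !SigmaE// dotM_diag_conj//.
set W := Q *m P^T.
have gt0 i j : l 0 i != l 0 j ->
    0 < (f l 0 i - f l 0 j) * (l 0 i - l 0 j).
  move=> lij; rewrite -(@pmulrn_lgt0 _ _ 2)// -(dotv_tperm i j hf Ml).
  apply: fm => //; first exact: hM.
  by move/rowP/(_ i); rewrite mxE tpermL; exact/eqP.
have ge0 i j : 0 <= W i j ^+ 2 * ((f l 0 i - f l 0 j) * (l 0 i - l 0 j)).
  rewrite mulr_ge0 ?sqr_ge0//.
  by have [->|/gt0/ltW//] := eqVneq (l 0 i) (l 0 j); rewrite subrr mulr0.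
rewrite lt_neqAle sumr_ge0 ?andbT => [|i _]; last by rewrite sumr_ge0.
apply/eqP => /esym/psumr_eq0P => s0; apply: ST; apply/eqP.
rewrite -subr_eq0 diag_conj_sub// -/W.
rewrite (_ : \matrix_(_, _) _ = 0) ?mulmx0 ?mul0mx//.
apply/matrixP => i j; rewrite [LHS]mxE [RHS]mxE.
have [->|lij] := eqVneq (l 0 i) (l 0 j); first by rewrite subrr mulr0.
have /psumr_eq0P Wi0 := s0 (fun i _ => sumr_ge0 _ (fun j _ => ge0 i j)) i isT.
have /eqP := Wi0 (fun j _ => ge0 i j) j isT.
by rewrite mulf_eq0 sqrf_eq0 (gt_eqF (gt0 _ _ lij)) orbF => /eqP ->; rewrite mul0r.
Qed.

(** * Diagonal matrices and the equivalence *)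

Lemma orthogonal_mx1 (R : realType) n : orthogonal_mx (1%:M : 'M[R]_n).
Proof. by rewrite /orthogonal_mx trmx1 mulmx1. Qed.

Lemma SymM_diag (R : realType) n (M : set 'rV[R]_n) (x : 'rV[R]_n) :
  M x -> SymM M (diag_mx x).
Proof.
by move/(SymM_orthogonal (@orthogonal_mx1 R n)); rewrite trmx1 mulmx1 mul1mx.
Qed.

Lemma dotM_Sigma_diag (R : realType) n (M : set 'rV[R]_n)
    (f : 'rV[R]_n -> 'rV[R]_n) (x y : 'rV[R]_n) :
  symmetric_fun M f -> M x -> M y ->
  dotM (Sigma M f (diag_mx x) - Sigma M f (diag_mx y))
       (diag_mx x - diag_mx y) = dotv (f x - f y) (x - y).
Proof.
move=> hf Mx My.
have SE z : M z -> Sigma M f (diag_mx z) = diag_mx (f z).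
  move/(SigmaE hf (@orthogonal_mx1 R n)).
  by rewrite trmx1 !mulmx1 !mul1mx.
rewrite !SE// -!raddfB /dotM tr_diag_mx mulmx_diag mxtrace_diag.
by apply: eq_bigr => i _; rewrite !mxE.
Qed.

Theorem theorem3p25 (R : realType) (n : nat) (hn : (1 <= n)%N)
    (M : set 'rV[R]_n) (f : 'rV[R]_n -> 'rV[R]_n)
    (hM : symmetric_set M) (hf : symmetric_fun M f) :
  (vector_monotone M f <-> matrix_monotone M f) /\
  (strictly_vector_monotone M f <-> strictly_matrix_monotone M f).
Proof.
split; split=> fm.
- move=> S T /(SymM_sorted hM)[Q [l [QQ Ml lN ->]]].
  move=> /(SymM_sorted hM)[P [m [PP Mm mN ->]]].
  exact: le_trans (fm _ _ Ml Mm) (Sigma_dotM_ge hM hf fm PP QQ Ml Mm lN mN).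
- move=> x y Mx My; rewrite -(dotM_Sigma_diag hf Mx My).
  by apply: fm; exact: SymM_diag.
- move=> S T /(SymM_sorted hM)[Q [l [QQ Ml lN ->]]].
  move=> /(SymM_sorted hM)[P [m [PP Mm mN ->]]] ST.
  have fmW := strictly_vector_monotoneW fm.
  have [lm|/eqP lm] := eqVneq l m.
    by rewrite -lm in ST *; exact: Sigma_dotM_isospectral_gt0.
  exact: lt_le_trans (fm _ _ Ml Mm lm) (Sigma_dotM_ge hM hf fmW PP QQ Ml Mm lN mN).
- move=> x y Mx My xy; rewrite -(dotM_Sigma_diag hf Mx My).
  apply: fm; [exact: SymM_diag..|].
  move=> /matrixP xyE; apply: xy; apply/rowP => i.
  by have := xyE i i; rewrite !mxE eqxx !mulr1n.
Qed.
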